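(* If $n$ is sufficiently large, then \[ \mathrm{La}(n,\mathcal{P}_5,\#P_2)=5\binom{n-2}{\lfloor n/2\rfloor-1}=\left(\frac54+o(1)\right)\binom{n}{\lfloor n/2\rfloor}. \]
   Context: $2^{[n]}$ is the Boolean lattice of all subsets of $[n]=\{1,\dots,n\}$ ordered by inclusion. A poset $P$ is a (weak) subposet of a poset $Q$ if there is an injection $f:P\to Q$ such that $p\le_P p'$ implies $f(p)\le_Q f(p')$. $\mathcal{P}_k$ denotes the family of all posets on $k$ elements whose undirected Hasse diagram is a path; a family $\mathcal{F}\subseteq 2^{[n]}$ is $\mathcal{P}_k$-free if no poset of $\mathcal{P}_k$ is a weak subposet of $(\mathcal{F},\subseteq)$. A copy of $P_2$ (the 2-element chain) in $\mathcal{F}$ is a pair $F\subsetneq F'$ with $F,F'\in\mathcal{F}$. $\mathrm{La}(n,\mathcal{P}_k,\#P_2)$ is the maximum number of copies of $P_2$ in a $\mathcal{P}_k$-free family $\mathcal{F}\subseteq 2^{[n]}$. *)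

(* Defs.v *)
From mathcomp Require Import all_boot all_order boolp.

Set Implicit Arguments.
Unset Strict Implicit.
Unset Printing Implicit Defensive.

Definition covers (d : Order.disp_t) (P : finPOrderType d) (x y : P) : bool :=
  (x < y)%O && ~~ [exists z : P, (x < z)%O && (z < y)%O].

Definition hasse_adj (d : Order.disp_t) (P : finPOrderType d) (x y : P) : bool :=
  covers x y || covers y x.

(* Membership in the family of posets on k elements whose undirected Hasse
   diagram is a path: s lists the elements of P along the path. *)
Definition path_poset (k : nat) (d : Order.disp_t) (P : finPOrderType d) : Prop :=
  exists s : 'I_k -> P,
    bijective s /\
    forall i j : 'I_k,
      hasse_adj (s i) (s j) = ((i.+1 == j :> nat) || (j.+1 == i :> nat)).

Definition weak_subposet (d : Order.disp_t) (P : porderType d)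
    (n : nat) (F : {set {set 'I_n}}) : Prop :=
  exists f : P -> {set 'I_n},
    [/\ injective f,
        forall p : P, f p \in F &
        forall p p' : P, (p <= p')%O -> f p \subset f p'].

Definition path_free (k n : nat) (F : {set {set 'I_n}}) : Prop :=
  forall (d : Order.disp_t) (P : finPOrderType d),
    path_poset k P -> ~ weak_subposet P F.

Definition copies_P2 (n : nat) (F : {set {set 'I_n}}) : nat :=
  #|[set p : {set 'I_n} * {set 'I_n} |
      [&& p.1 \in F, p.2 \in F & p.1 \proper p.2]]|.

Definition La_path_P2 (n k : nat) : nat :=
  \max_(F : {set {set 'I_n}} | `[< path_free k F >]) copies_P2 F.

(* Main.v *)
(* Read a permutation as the maximal chain of its initial segments. A chain cannot
   meet the convex hulls of two components of the comparability graph, so for the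
   upper bound it suffices to show that the hull of a component with m pairs is met
   by at least the fraction m / (5 'C(n - 2, n./2 - 1)) of the chains.

   Call a vertex heavy if it has at least three neighbours that are not leaves. A
   heavy vertex lies on a 4-cycle, which is the whole component as there is no path
   on five vertices. Such a component is a 4-chain with 6 pairs, or it contains a
   3-chain and has at most 5 pairs. The hull of a chain of d + 1 sets contains an
   interval [A, D] with #|D :\: A| >= d, and the fraction of the chains that meet
   [A, D] is 1 / 'C(n - #|D :\: A|, #|A|).

   In a component K without heavy vertices the edges can be charged to the vertices
   so that no vertex receives more than one edge in total. Hence K has at most #|K|
   pairs, and Bonferroni's inequality shows that K is met by nearly the fraction
   #|K| / 'C(n, n./2) of the chains; this suffices because
   'C(n, n./2) <= 4 'C(n - 2, n./2 - 1) leaves a factor 5/4 to spare.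

   Equality is attained by the disjoint union of the intervals [T, T + {x, y}] with
   T of size n./2 - 1 avoiding x and y, each of which contains 5 pairs. *)

From HB Require Import structures.
Require Import Defs.
From mathcomp Require Import boolp classical_sets reals topology normedtype sequences ring.
From mathcomp Require Import all_boot all_order all_algebra all_fingroup zify.

Set Implicit Arguments.
Unset Strict Implicit.
Unset Printing Implicit Defensive.

(** * Central binomial coefficients *)

Definition central_bin (n : nat) : nat := 'C(n, n./2).

Lemma central_bin_gt0 n : 0 < central_bin n.
Proof. by rewrite bin_gt0; lia. Qed.

Lemma bin_le_central n m : 'C(n, m) <= central_bin n.
Proof.
have incr : {in geq n./2 &, {homo binomial n : i j / i <= j}}.
  apply: homo_leq_in => // [? ? ?|i j + jn k /andP[_ /ltnW kj]|i _].
  - exact: leq_trans.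
  - by move=> _; apply: leq_trans kj jn.
  - by rewrite inE => lt_i; have := mul_bin_left n i; nia.
have [le_m|lt_m] := leqP m n./2; first by apply: incr; rewrite ?inE.
have [le_mn|lt_nm] := leqP m n; last by rewrite bin_small.
by rewrite -bin_sub //; apply: incr; rewrite ?inE; lia.
Qed.

Lemma leq_central_bin : {homo central_bin : n m / n <= m}.
Proof. by move=> n m /leq_bin2l le_nm; apply: leq_trans (le_nm _) (bin_le_central _ _). Qed.

Lemma central_binS n : 1 < n -> 3 * central_bin n <= 2 * central_bin n.+1.
Proof.
move=> n_gt1; have := bin_le_central n.+1 n./2.+1; have := mul_bin_left n n./2.
rewrite binS /central_bin => binE le_central.
have : n./2.+1 * 'C(n, n./2) <= n./2.+1 * (2 * 'C(n, n./2.+1)).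
  by rewrite mulnCA binE mulnA leq_mul2r; lia.
by rewrite leq_pmul2l //; lia.
Qed.

Lemma mul_bin_diag_down n m :
  n.+2 * n.+1 * 'C(n, m) = m.+1 * (n.+1 - m) * 'C(n.+2, m.+1).
Proof.
by rewrite -mulnA (mul_bin_down n.+1) mulnCA (mul_bin_diag n.+2) mulnCA mulnA.
Qed.

Lemma central_bin_le4 n : central_bin n.+2 <= 4 * central_bin n.
Proof.
have := mul_bin_diag_down n n./2; rewrite /central_bin /=.
have : n.+2 * n.+1 <= 4 * (n./2.+1 * (n.+1 - n./2)) by nia.
nia.
Qed.

Lemma central_bin_ge4 n : 4 * n.+1 * central_bin n <= n.+2 * central_bin n.+2.
Proof.
have := mul_bin_diag_down n n./2; rewrite /central_bin /=.
have : 4 * (n./2.+1 * (n.+1 - n./2)) <= n.+2 * n.+2 by nia.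
nia.
Qed.

Lemma double_bin_le_central n m : 3 * m.+1 <= n -> 2 * 'C(n, m) <= central_bin n.
Proof.
move=> le_mn; apply: leq_trans (bin_le_central n m.+1).
by have := mul_bin_left n m; nia.
Qed.

Lemma leq_bin_row n m : 0 < m < n -> n <= 'C(n, m).
Proof.
elim: n m => [|n IHn] [|m] //= /[!ltnS] lt_mn; rewrite binS.
have [<-|neq_mn] := eqVneq m.+1 n; first by rewrite binn add1n binSn.
have := IHn m.+1; have : 0 < 'C(n, m) by rewrite bin_gt0 ltnW.
lia.
Qed.

(** * Maximal chains of subsets *)

Definition nested (T : finType) (A B : {set T}) : bool := (A \subset B) || (B \subset A).

Lemma nestedxx (T : finType) (A : {set T}) : nested A A.
Proof. by rewrite /nested subxx. Qed.

Lemma nested_sym (T : finType) : symmetric (@nested T).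
Proof. by move=> A B; rewrite /nested orbC. Qed.

Lemma nested_proper (T : finType) (A B : {set T}) :
  (A != B) && nested A B = (A \proper B) || (B \proper A).
Proof. by rewrite /nested !properEneq (eq_sym B) andb_orr. Qed.

Lemma nested_card_inj (T : finType) (A B : {set T}) : nested A B -> #|A| = #|B| -> A = B.
Proof.
by case/orP=> sAB eqAB; apply/eqP; [|rewrite eq_sym]; rewrite eqEcard sAB eqAB leqnn.
Qed.

Definition is_chain (T : finType) (K : {set {set T}}) : bool :=
  [forall A in K, forall B in K, nested A B].

Lemma is_chainP (T : finType) (K : {set {set T}}) :
  reflect {in K &, forall A B, nested A B} (is_chain K).
Proof.
apply: (iffP forall_inP) => [chainK A B AK BK|chainK A AK].
  by have /forall_inP := chainK A AK; apply.
by apply/forall_inP => B BK; apply: chainK.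
Qed.

Lemma cardsC_ord n (A : {set 'I_n}) : #|~: A| = n - #|A|.
Proof. by rewrite cardsCs setCK card_ord. Qed.

Lemma exists_perm_on_imset (T : finType) (Y A B : {set T}) :
    A \subset Y -> B \subset Y -> #|A| = #|B| ->
  exists2 t : {perm T}, perm_on Y t & t @: A = B.
Proof.
move cardA: #|A| => m; elim: m => [|m IHm] in A B cardA *.
  move=> _ _ /esym/cards0_eq ->; exists 1%g; first exact: perm_on1.
  by rewrite (cards0_eq cardA) imset0.
move=> AY BY cardB.
have /card_gt0P[a aA] : 0 < #|A| by rewrite cardA.
have /card_gt0P[b bB] : 0 < #|B| by rewrite -cardB.
have [||||t tY tA] := IHm (A :\ a) (B :\ b).
- by move: cardA; rewrite (cardsD1 a) aA => -[].
- exact: subset_trans (subD1set _ _) AY.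
- exact: subset_trans (subD1set _ _) BY.
- by move: cardB; rewrite (cardsD1 b) bB => -[].
have taB : t a \notin B :\ b by rewrite -tA mem_imset ?setD11 //; apply: perm_inj.
exists (t * tperm (t a) b)%g.
  apply: perm_onM => //; apply: subset_trans (tperm_on _ _) _.
  by rewrite subUset !sub1set (perm_closed _ tY) (subsetP AY) // (subsetP BY).
rewrite -(setD1K aA) imsetU1 permM tpermL -[RHS](setD1K bB) -tA.
congr (_ |: _); apply: eq_in_imset => x xA /=; rewrite permM tpermD //.
  by apply: contraNneq taB => ->; rewrite -tA imset_f.
by apply: contraTneq (imset_f t xA) => <-; rewrite tA setD11.
Qed.

Section InitialSegments.
Variable n : nat.
Implicit Types (s t : 'S_n) (A B D S Y : {set 'I_n}).

(* [s x] is the position of [x] in the linear order given by [s]. *)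
Definition initial s Y A : bool := [forall x in A, forall y in Y :\: A, s x < s y].

Lemma initialP s Y A :
  reflect {in A & Y :\: A, forall x y, s x < s y} (initial s Y A).
Proof.
apply: (iffP forall_inP) => [initA x y xA yA|initA x xA].
  by have /forall_inP := initA x xA; apply.
by apply/forall_inP => y yA; apply: initA.
Qed.

Lemma initial_nested s Y A B : A \subset Y -> B \subset Y ->
  initial s Y A -> initial s Y B -> nested A B.
Proof.
move=> /subsetP AY /subsetP BY /initialP initA /initialP initB.
apply/contraT; rewrite negb_or => /andP[/subsetPn[x xA xB] /subsetPn[y yB yA]].
have := initA x y xA; rewrite inE yA BY // => /(_ isT) lt_xy.
by have := initB y x yB; rewrite inE xB AY // ltnNge ltnW // => /(_ isT).
Qed.

Lemma initialM t s Y A : perm_on Y t -> initial (t * s) Y A = initial s Y (t @: A).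
Proof.
move=> tY; have in_tA x : (t x \in t @: A) = (x \in A) by rewrite mem_imset //; apply: perm_inj.
apply/initialP/initialP => initA.
  move=> _ z /imsetP[x xA ->] /setDP[zY ztA].
  have := initA x ((t^-1)%g z) xA; rewrite !permM permKV; apply.
  by rewrite inE -(perm_closed _ tY) -in_tA permKV ztA.
move=> x y xA yA; rewrite !permM; apply: initA; first by rewrite in_tA.
by rewrite in_setD in_tA perm_closed // -in_setD.
Qed.

Lemma exists_initial s Y a : a <= #|Y| ->
  exists A, [/\ A \subset Y, #|A| = a & initial s Y A].
Proof.
elim: a => [_|a IHa lt_aY].
  by exists set0; rewrite sub0set cards0; split=> //; apply/initialP => x y; rewrite inE.
have [A [AY cardA /initialP initA]] := IHa (ltnW lt_aY).
have /card_gt0P[y0 y0YA] : 0 < #|Y :\: A| by rewrite cardsDS // cardA subn_gt0.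
case: (arg_minnP (fun y => s y : nat) y0YA) => y /setDP[yY yA] ymin.
exists (y |: A); split; first by rewrite subUset sub1set yY.
  by rewrite cardsU1 yA cardA.
apply/initialP => x z; rewrite !inE negb_or => /orP[/eqP ->|xA] /andP[/andP[zy zA] zY].
  have le_yz : s y <= s z by apply: ymin; apply/setDP.
  by rewrite ltn_neqAle le_yz andbT; apply: contra zy => /eqP/val_inj/perm_inj ->.
by apply: initA; rewrite // inE zA.
Qed.

(* The initial segments of [Y] of a given size partition [Q] into equinumerous
   parts, permuted by left translations. *)
Lemma card_initial (Q : {set 'S_n}) Y A :
    (forall t, perm_on Y t -> forall s, ((t * s)%g \in Q) = (s \in Q)) ->
    A \subset Y ->
  'C(#|Y|, #|A|) * #|[set s in Q | initial s Y A]| = #|Q|.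
Proof.
move=> QY AY; pose sizeA := [set X : {set 'I_n} | X \subset Y & #|X| == #|A|].
rewrite -cards_draws -/sizeA -sum_nat_const.
have equinumerous X : X \in sizeA ->
    #|[set s in Q | initial s Y A]| = #|[set s in Q | initial s Y X]|.
  rewrite inE => /andP[XY /eqP eqXA].
  have [t tY <-] := exists_perm_on_imset AY XY (esym eqXA).
  rewrite -(card_preimset _ (mulgI t)); apply: eq_card => s.
  by rewrite !inE QY // initialM.
rewrite (eq_bigr _ equinumerous).
under eq_bigr => X _ do rewrite -sum1_card (eq_bigl _ _ (fun s => in_set _ _)).
rewrite (exchange_big_dep (mem Q)) /= => [|X s _ /andP[]//].
rewrite -sum1_card; apply: eq_bigr => s sQ.
have [X [XY cardX initX]] := exists_initial s (subset_leq_card AY).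
rewrite (big_pred1 X) // => Z; rewrite !inE sQ /=.
apply/andP/eqP => [[/andP[ZY /eqP cardZ] initZ]|->]; last by rewrite XY cardX eqxx.
by apply: nested_card_inj (initial_nested ZY XY initZ initX) _; rewrite cardX.
Qed.

Definition chains_through A : {set 'S_n} := [set s | initial s setT A].

Lemma chains_throughP s A :
  reflect (forall x y, x \in A -> y \notin A -> s x < s y) (s \in chains_through A).
Proof.
rewrite inE; apply: (iffP (initialP _ _ _)) => initA x y xA yA; apply: initA => //.
  by rewrite !inE yA.
by move: yA; rewrite !inE andbT.
Qed.

Lemma chains_through_nested s A B :
  s \in chains_through A -> s \in chains_through B -> nested A B.
Proof. by rewrite !inE; apply: initial_nested; apply: subsetT. Qed.

Lemma chains_through0 : chains_through set0 = setT.
Proof. by apply/setP => s; rewrite in_setT; apply/chains_throughP => x y; rewrite inE. Qed.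

Lemma chains_throughT : chains_through setT = setT.
Proof. by apply/setP => s; rewrite in_setT; apply/chains_throughP => x y; rewrite !inE. Qed.

Lemma card_chains_through A : 'C(n, #|A|) * #|chains_through A| = n`!.
Proof.
have := @card_initial setT setT A; rewrite !cardsT card_ord card_Sn => <- //.
- by congr (_ * _); apply: eq_card => s; rewrite !inE.
- by move=> t _ s; rewrite !inE.
Qed.

Lemma chains_throughM t s A :
  t @: A = A -> ((t * s)%g \in chains_through A) = (s \in chains_through A).
Proof. by move=> tA; rewrite !inE initialM ?tA //; apply/subsetP => x; rewrite inE. Qed.

Lemma card_chains_through_sub A B : A \subset B ->
  'C(#|B|, #|A|) * #|chains_through A :&: chains_through B| = #|chains_through B|.
Proof.
move=> sAB; rewrite -(@card_initial (chains_through B) B A) // => [|t tB s]; last first.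
  by rewrite chains_throughM // im_perm_on.
congr (_ * _); apply: eq_card => s; rewrite in_setI [RHS]in_set andbC.
apply: andb_id2l => /chains_throughP sB; apply/chains_throughP/initialP => initA x y xA.
  by case/setDP=> _; apply: initA.
have [yB yA|yB _] := boolP (y \in B); first by apply: initA; rewrite // inE yA.
by apply: sB => //; apply: (subsetP sAB).
Qed.

Lemma card_chains_through_super A B : B \subset A ->
  'C(#|~: B|, #|A :\: B|) * #|chains_through A :&: chains_through B| = #|chains_through B|.
Proof.
move=> sBA; rewrite -(@card_initial (chains_through B) (~: B) (A :\: B)).
- congr (_ * _); apply: eq_card => s; rewrite in_setI [RHS]in_set andbC.
  apply: andb_id2l => /chains_throughP sB; apply/chains_throughP/initialP => initA x y.
    by case/setDP=> xA _; rewrite !inE => /andP[+ yB]; rewrite yB /=; apply: initA.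
  move=> xA yA; have yB : y \notin B by apply: contra yA; apply: (subsetP sBA).
  have [xB|xB] := boolP (x \in B); first exact: sB.
  by apply: initA; rewrite !inE ?xB // (negbTE yA) andbF.
- move=> t tB s; rewrite chains_throughM // -[RHS]imset_id.
  by apply: eq_in_imset => x xB; rewrite (out_perm tB) // inE negbK.
- by rewrite setDE subsetIr.
Qed.

Lemma card_chains_through_interval A D : A \subset D ->
  n`! <= 'C(n - #|D :\: A|, #|A|) *
    #|\bigcup_(S : {set 'I_n} | (A \subset S) && (S \subset D)) chains_through S|.
Proof.
move=> sAD; have AY : A \subset ~: (D :\: A) by rewrite setCD subsetUr.
have := @card_initial setT _ A _ AY.
rewrite cardsT card_Sn => <- => [|t _ s]; last by rewrite !inE.
rewrite cardsC_ord leq_mul2l; apply/orP; right.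
apply/subset_leq_card/subsetP => s; rewrite !inE => /initialP initA.
apply/bigcupP; exists [set z | [forall y in ~: D, s z < s y]].
  apply/andP; split; apply/subsetP => z; rewrite !inE.
    move=> zA; apply/forall_inP => y; rewrite inE => yD; apply: initA => //.
    by rewrite !inE (negbTE yD) andbF (contra (subsetP sAD y)).
  move/forall_inP=> zlt; apply: contraT => zD.
  by have := zlt z; rewrite inE zD ltnn => /(_ isT).
apply/chains_throughP => x y; rewrite !inE => /forall_inP xlt /forall_inPn[z zD].
by rewrite -leqNgt; apply: leq_trans; apply: xlt.
Qed.

Lemma card_chains_through_nested A B : A != B -> nested A B ->
    A \notin [set set0; setT] -> B \notin [set set0; setT] ->
  maxn 2 (minn #|B| #|~: B|) * #|chains_through A :&: chains_through B|
    <= #|chains_through B|.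
Proof.
rewrite !inE !negb_or -!card_gt0 -!properT => neqAB nestedAB.
move=> /andP[A0 /proper_card An] /andP[B0 /proper_card Bn].
rewrite !cardsT card_ord in An Bn; have cardC : #|~: B| = n - #|B| := cardsC_ord B.
have : (A \proper B) || (B \proper A) by rewrite -nested_proper neqAB.
case/orP=> [AB|BA].
  rewrite -(card_chains_through_sub (proper_sub AB)) leq_mul2r; apply/orP; right.
  by have := proper_card AB; have := @leq_bin_row #|B| #|A|; lia.
rewrite -(card_chains_through_super (proper_sub BA)) leq_mul2r; apply/orP; right.
rewrite cardC cardsDS ?proper_sub //; have := proper_card BA.
by have := @leq_bin_row (n - #|B|) (#|A| - #|B|); lia.
Qed.

End InitialSegments.

(** * Weighted sums *)

Lemma leq_sum_symmetrized (I : finType) (K : {set I}) (v w : I -> I -> nat) :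
    {in K &, forall i j, v i j + v j i <= w i j + w j i} ->
  \sum_(i in K) \sum_(j in K) v i j <= \sum_(i in K) \sum_(j in K) w i j.
Proof.
move=> le_vw; have double (f : I -> I -> nat) :
    2 * \sum_(i in K) \sum_(j in K) f i j = \sum_(i in K) \sum_(j in K) (f i j + f j i).
  rewrite mul2n -addnn [in X in _ + X]exchange_big -big_split.
  by apply: eq_bigr => i _; rewrite -big_split.
rewrite -(@leq_pmul2l 2) // !double; apply: leq_sum => i iK; apply: leq_sum => j jK.
exact: le_vw.
Qed.

Lemma double_card_le_weight (I : finType) (M : {set I}) (w : I -> I -> nat) :
    {in M &, forall i j, i != j -> 2 <= w i j + w j i} ->
  2 * #|M| <= 2 * (M != set0) + \sum_(i in M) \sum_(j in M) w i j.
Proof.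
move=> w_ge2; have := @leq_sum_symmetrized _ M (fun i j => i != j) w.
have sum_neq i : i \in M -> \sum_(j in M) (i != j) = #|M|.-1.
  move=> iM; rewrite (cardsD1 i) iM -sum1_card big_mkcond [RHS]big_mkcond.
  by apply: eq_bigr => j _; rewrite !inE eq_sym; case: (j \in M); case: (j == i).
rewrite (eq_bigr _ sum_neq) sum_nat_const -card_gt0 => le_w.
suff : #|M| * #|M|.-1 <= \sum_(i in M) \sum_(j in M) w i j by case: #|M| => [|[|m]]; nia.
apply: le_w => i j iM jM /=; rewrite eq_sym; have [//|neq_ij] := eqVneq j i.
by apply: w_ge2; rewrite // eq_sym.
Qed.

Lemma weighted_bonferroni (I S : finType) (K : {set I}) (X : I -> {set S})
    (w : I -> I -> nat) :
    {in K &, forall i j, i != j -> ~~ [disjoint X i & X j] -> 2 <= w i j + w j i} ->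
  2 * \sum_(i in K) #|X i| <=
    2 * #|\bigcup_(i in K) X i| + \sum_(i in K) \sum_(j in K) w i j * #|X i :&: X j|.
Proof.
move=> w_ge2; pose M s := [set i in K | s \in X i].
have cardE (Y : {set S}) : #|Y| = \sum_s (s \in Y) by rewrite -sum1_card big_mkcond.
have sumM s (F : I -> nat) : \sum_(i in M s) F i = \sum_(i in K) (s \in X i) * F i.
  rewrite big_mkcond [RHS]big_mkcond; apply: eq_bigr => i _; rewrite inE.
  by case: (i \in K); case: (s \in X i); rewrite ?mul1n.
have -> : \sum_(i in K) #|X i| = \sum_s #|M s|.
  under eq_bigr do rewrite cardE; rewrite exchange_big; apply: eq_bigr => s _.
  by rewrite -sum1_card sumM; apply: eq_bigr => i _; rewrite muln1.
have -> : \sum_(i in K) \sum_(j in K) w i j * #|X i :&: X j| =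
    \sum_s \sum_(i in M s) \sum_(j in M s) w i j.
  under [RHS]eq_bigr do rewrite sumM.
  rewrite [RHS]exchange_big; apply: eq_bigr => i _.
  under [RHS]eq_bigr do rewrite sumM big_distrr.
  rewrite [RHS]exchange_big; apply: eq_bigr => j _.
  rewrite cardE big_distrr; apply: eq_bigr => s _ /=.
  by rewrite inE mulnA mulnb mulnC.
rewrite [in leqRHS]cardE !big_distrr -big_split leq_sum // => s _ /=.
have -> : s \in \bigcup_(i in K) X i = (M s != set0).
  apply/bigcupP/set0Pn => [[i iK si]|[i]]; last by rewrite inE => /andP[iK si]; exists i.
  by exists i; rewrite inE iK.
apply: double_card_le_weight => i j; rewrite !inE => /andP[iK si] /andP[jK sj] neq_ij.
by apply: w_ge2 => //; apply/pred0Pn; exists s; rewrite /= si.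
Qed.

Lemma leq_weighted_sum (I : finType) (K : {set I}) (w x : I -> nat) m c t y :
    \sum_(i in K) w i <= m -> t <= c * y ->
    {in K, forall i, 0 < w i -> c * x i + t <= c * y} ->
  m * t + c * \sum_(i in K) w i * x i <= m * (c * y).
Proof.
move=> le_wm le_ty le_xy.
have : c * \sum_(i in K) w i * x i <= \sum_(i in K) w i * (c * y - t).
  rewrite big_distrr; apply: leq_sum => i iK /=; case: (posnP (w i)) => [-> //|w_gt0].
    by rewrite muln0.
  by rewrite mulnCA leq_mul2l leq_subRL // addnC le_xy ?orbT.
rewrite -big_distrl /=; have := leq_mul le_wm (leqnn (c * y - t)).
rewrite mulnBr; have : m * t <= m * (c * y) by rewrite leq_mul2l le_ty orbT.
lia.
Qed.

(** * Graphs without long paths *)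

Definition simple_paths_lt (T : eqType) (e : rel T) (k : nat) : Prop :=
  forall p, sorted e p -> uniq p -> size p < k.

Lemma ucycle_component (T : finType) (e : rel T) (p : seq T) :
    symmetric e -> simple_paths_lt e (size p).+1 -> ucycle e p ->
  {in p, forall x, connect e x =i p}.
Proof.
move=> sym_e short /andP[cycle_p uniq_p].
have closed_p : closed e (mem p).
  apply: intro_closed => [|x y exy xp]; first exact: sym_connect_sym.
  apply/contraT => yp; have [i q rot_p] := rot_to xp.
  have := short (y :: rot i p); rewrite /= size_rot ltnn; apply.
    rewrite rot_p /= sym_e exy; move: cycle_p.
    by rewrite -(rot_cycle i) rot_p /= rcons_path => /andP[].
  by rewrite mem_rot yp rot_uniq.
move=> x xp y; apply/idP/idP => [/(closed_connect closed_p) <- //|yp].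
exact: connect_cycle cycle_p x y xp yp.
Qed.

Section ForbiddenPath5.
Variables (T : finType) (e : rel T).

Definition nonleaf (x : T) : bool := 1 < #|[set y | e x y]|.

Definition heavy (x : T) : bool := 2 < #|[set y | e x y && nonleaf y]|.

(* The weight 2 of an edge is charged to the leaf if one end is a leaf, and is
   shared equally by two nonleaves; [edge_weight a b] is the part charged to [b]. *)
Definition edge_weight (a b : T) : nat :=
  if e a b then if nonleaf b then nonleaf a : nat else 2 else 0.

Hypothesis sym_e : symmetric e.

Lemma edge_weight_ge2 a b : e a b -> 2 <= edge_weight a b + edge_weight b a.
Proof.
by rewrite /edge_weight (sym_e b) => ->; case: (nonleaf a); case: (nonleaf b).
Qed.

Lemma sum_edge_weight_le2 b : ~~ heavy b -> \sum_a edge_weight a b <= 2.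
Proof.
rewrite -leqNgt /edge_weight -big_mkcond /=; have [nonleaf_b|leaf_b] := boolP (nonleaf b).
  apply: leq_trans; rewrite -sum1_card big_mkcond [leqRHS]big_mkcond leq_sum // => a _.
  by rewrite inE sym_e; case: (e b a); case: (nonleaf a).
move=> _; rewrite sum_nat_cond_const.
have -> : [set a | e a b] = [set a | e b a] by apply/setP => a; rewrite !inE sym_e.
by move: leaf_b; rewrite /nonleaf; lia.
Qed.

Hypotheses (irr_e : irreflexive e) (short : simple_paths_lt e 5).

Let edge_neq x y : e x y -> x != y.
Proof. by apply: contraTneq => ->; rewrite irr_e. Qed.

Let no_path5 a b c d f : e a b -> e b c -> e c d -> e d f ->
  ~~ [&& a != c, a != d, a != f, b != d, b != f & c != f].
Proof.
move=> ab bc cd df; apply/negP => /and5P[ac ad af bd /andP[bf cf]].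
have := @short [:: a; b; c; d; f]; rewrite /= ab bc cd df !inE !negb_or.
by rewrite ac ad af bd bf cf !edge_neq // => /(_ isT isT).
Qed.

Lemma nonleaf_neighbour x : nonleaf x -> forall b, exists2 w, e x w & w != b.
Proof.
case/card_gt1P=> y [z []]; rewrite !inE => exy exz yz b.
by have [yb|yb] := eqVneq y b; [exists z; rewrite // -yb eq_sym|exists y].
Qed.

(* Otherwise, [x] and [y] have neighbours [w] and [q] other than [b], and either
   x - w - y - b - z or w - x - b - y - q is a path. *)
Lemma nonleaf_neighbours_adjacent b x y z : e b x -> e b y -> e b z ->
    [&& x != y, x != z & y != z] -> nonleaf x -> nonleaf y ->
  e x y || e x z.
Proof.
move=> bx ey bz /and3P[xy xz yz].
move=> /nonleaf_neighbour/(_ b)[w xw wb] /nonleaf_neighbour/(_ b)[q yq qb].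
apply/contraT; rewrite negb_or => /andP[nxy nxz].
have wy : w != y by apply: contraNneq nxy => <-.
have wz : w != z by apply: contraNneq nxz => <-.
have qx : q != x by apply: contraNneq nxy => <-; rewrite sym_e.
have [xb yb] : e x b /\ e y b by rewrite ![e _ b]sym_e.
have [eq_qw|qw] := eqVneq q w.
  have wy_edge : e w y by rewrite sym_e -eq_qw.
  by have := no_path5 xw wy_edge yb bz; rewrite xy xz wb wz yz edge_neq.
have wx_edge : e w x by rewrite sym_e.
have := no_path5 wx_edge xb ey yq.
by rewrite wb wy xy [w == q]eq_sym qw [x == q]eq_sym qx [b == q]eq_sym qb.
Qed.

Lemma heavy_neighbours b : heavy b -> exists x y z,
  [/\ uniq [:: b; x; y; z], [/\ e b x, e b y & e b z], e x y & e y z].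
Proof.
case/card_gt2P=> x [y [z [[]]]]; rewrite !inE.
move=> /andP[bx nx] /andP[ey ny] /andP[bz nz] [xy yz zx].
have [yx zy xz] : [/\ y != x, z != y & x != z].
  by rewrite [y == x]eq_sym [z == y]eq_sym [x == z]eq_sym.
have [neq_bx neq_by neq_bz] : [/\ b != x, b != y & b != z] by split; apply: edge_neq.
have uniqE := (inE, negb_or, neq_bx, neq_by, neq_bz, xy, xz, yz, yx, zx, zy).
have := nonleaf_neighbours_adjacent bx ey bz; rewrite xy xz yz => /(_ isT nx ny).
have := nonleaf_neighbours_adjacent ey bx bz; rewrite yx yz xz => /(_ isT ny nx).
have := nonleaf_neighbours_adjacent bz bx ey; rewrite zx zy xy => /(_ isT nz nx).
rewrite ![e z _]sym_e [e y x]sym_e.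
have [exy|_] := boolP (e x y); have [exz|_] := boolP (e x z); rewrite /= ?orbF => //.
- by move=> _ _ _; exists y, x, z; rewrite /= !uniqE [e y x]sym_e.
- by move=> eyz _ _; exists x, y, z; rewrite /= !uniqE.
- by move=> _ eyz _; exists x, z, y; rewrite /= !uniqE [e z y]sym_e.
Qed.

End ForbiddenPath5.

(** * Path posets *)

Definition graded (T : Type) (r : rel T) (h : T -> nat) : Prop :=
  forall x y, r x y -> h y = (h x).+1.

Lemma graded_connect (T : finType) (r : rel T) (h : T -> nat) x y :
  graded r h -> connect r x y -> x != y -> h x < h y.
Proof.
move=> gr /connectP[p]; elim: p x => [|z p IHp] x /=; first by move=> _ ->; rewrite eqxx.
case/andP=> /gr hz zp y_last _; have [<-|neq_zy] := eqVneq z y; first by rewrite hz.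
by apply: leq_trans (IHp z zp y_last neq_zy); rewrite hz.
Qed.

Lemma connect_graded_anti (T : finType) (r : rel T) (h : T -> nat) :
  graded r h -> antisymmetric (connect r).
Proof.
move=> gr x y /andP[xy yx]; have [//|neq_xy] := eqVneq x y.
have := graded_connect gr xy neq_xy; rewrite ltnNge ltnW //.
by apply: graded_connect gr yx _; rewrite eq_sym.
Qed.

Definition graded_order (T : finType) (r : rel T) (h : T -> nat) of graded r h : Type := T.

HB.instance Definition _ (T : finType) (r : rel T) (h : T -> nat) (gr : graded r h) :=
  Finite.copy (graded_order gr) T.

HB.instance Definition _ (T : finType) (r : rel T) (h : T -> nat) (gr : graded r h) :=
  Order.Le_isPOrder.Build (Order.Disp tt tt) (graded_order gr)
    (@connect0 T r) (connect_graded_anti gr) (@connect_trans T r).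

Lemma covers_graded_order (T : finType) (r : rel T) (h : T -> nat) (gr : graded r h)
    (x y : graded_order gr) :
  covers x y = r x y.
Proof.
have lt_h (a b : graded_order gr) : (a < b)%O -> h a < h b.
  by rewrite Order.POrderTheory.lt_neqAle => /andP[neq_ab /graded_connect]; apply.
have step_lt (a b : graded_order gr) : r a b -> (a < b)%O.
  move=> ab; rewrite Order.POrderTheory.lt_neqAle; apply/andP; split; last exact: connect1.
  by apply/eqP => eq_ab; have := gr _ _ ab; rewrite eq_ab; lia.
apply/andP/idP => [[]|xy]; last first.
  split; first exact: step_lt.
  by apply/existsPn => z; apply/negP => /andP[/lt_h + /lt_h]; rewrite (gr _ _ xy); lia.
rewrite Order.POrderTheory.lt_neqAle => /andP[neq_xy /connectP[[|z p] /=]].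
  by move=> _ eq_yx; rewrite eq_yx eqxx in neq_xy.
case/andP=> xz zp y_last /existsPn/(_ z); rewrite step_lt //=.
have [-> //|neq_zy] := eqVneq y z.
rewrite Order.POrderTheory.lt_neqAle eq_sym neq_zy => /negP[].
by apply/connectP; exists p.
Qed.

Definition fence_step (k : nat) (u : pred nat) : rel 'I_k :=
  fun i j => (i.+1 == j) && u i || (j.+1 == i) && ~~ u j.

(* Counts the up-steps before [i] and the down-steps from [i] on. *)
Definition fence_height (k : nat) (u : pred nat) (i : 'I_k) : nat :=
  \sum_(m < k) ((m < i) == u m).

Lemma fence_graded (k : nat) (u : pred nat) :
  graded (@fence_step k u) (@fence_height k u).
Proof.
have heightS (i j : 'I_k) : i.+1 = j -> fence_height u j + ~~ u i = fence_height u i + u i.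
  move=> ij; rewrite /fence_height (bigD1 i) // [in RHS](bigD1 i) //= -ij leqnn ltnn.
  rewrite (eq_bigr (fun m : 'I_k => (m < i) == u m : nat)); first by case: (u i); lia.
  by move=> m neq_mi; rewrite ltnS leq_eqVlt val_eqE (negbTE neq_mi).
move=> i j /orP[] /andP[/eqP /heightS ij ui]; move: ij; rewrite ?ui ?(negbTE ui); lia.
Qed.

Lemma fence_path_poset (k : nat) (u : pred nat) :
  path_poset k (graded_order (@fence_graded k u)).
Proof.
exists (id : 'I_k -> graded_order (@fence_graded k u)); split; first by exists id.
move=> i j; rewrite /hasse_adj !covers_graded_order /fence_step.
by case: (u i); case: (u j); rewrite ?andbT ?andbF ?orbF //= orbC.
Qed.

(** * Comparability graphs *)

Definition comparability (n : nat) (F : {set {set 'I_n}}) : rel {set 'I_n} :=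
  fun A B => [&& A \in F, B \in F, A != B & nested A B].

Lemma comparability_sym n (F : {set {set 'I_n}}) : symmetric (comparability F).
Proof. by move=> A B; rewrite /comparability andbCA eq_sym nested_sym. Qed.

Lemma comparability_irr n (F : {set {set 'I_n}}) : irreflexive (comparability F).
Proof. by move=> A; rewrite /comparability eqxx !andbF. Qed.

Lemma path_free_simple_paths_lt k n (F : {set {set 'I_n}}) :
  1 < k -> path_free k F -> simple_paths_lt (comparability F) k.
Proof.
move=> k_gt1 freeF p /(sortedP set0) edge uniq_p; rewrite ltnNge; apply/negP => le_kp.
pose u i := nth set0 p i \subset nth set0 p i.+1.
apply: (freeF _ _ (@fence_path_poset k u)).
exists (fun i : graded_order (@fence_graded k u) => nth set0 p (i : 'I_k)).
have ltp (i : 'I_k) : i < size p by apply: leq_trans le_kp.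
split=> [i j /eqP|i|i j].
- by rewrite nth_uniq ?ltp // => /eqP/val_inj.
- have [lt_ip|le_pi] := ltnP (i : 'I_k).+1 (size p); first by case/and4P: (edge _ lt_ip).
  have i_last : (i : 'I_k) = (size p).-2.+1 :> nat by have := ltp i; lia.
  by rewrite i_last; have /edge/and4P[] : (size p).-2.+1 < size p by lia.
case/connectP=> q; elim: q i => [i _ -> //|l q IHq i /= /andP[step_il pq]].
move=> /(IHq l pq); apply: subset_trans.
case/orP: step_il => /andP[/eqP step] /=; rewrite /u -step // => /negbTE not_up.
have /edge/and4P[_ _ _] : l.+1 < size p by rewrite step ltp.
by rewrite /nested not_up.
Qed.

Definition proper_pairs (T : finType) (K : {set {set T}}) : {set {set T} * {set T}} :=
  [set p | [&& p.1 \in K, p.2 \in K & p.1 \proper p.2]].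

Lemma copies_P2E n (F : {set {set 'I_n}}) : copies_P2 F = #|proper_pairs F|.
Proof. by []. Qed.

Lemma card_proper_pairs (T : finType) (K : {set {set T}}) :
  #|proper_pairs K| = \sum_(A in K) \sum_(B in K) (A \proper B).
Proof.
rewrite pair_big_dep /= -sum1_card big_mkcond [RHS]big_mkcond.
apply: eq_bigr => -[A B] _; rewrite inE /=.
by case: (A \in K); case: (B \in K); case: (A \proper B).
Qed.

Lemma card_proper_pairs_leqif (T : finType) (K : {set {set T}}) :
  #|proper_pairs K| <= 'C(#|K|, 2) ?= iff is_chain K.
Proof.
pose support (p : {set T} * {set T}) := [set p.1; p.2].
have support_inj : {in proper_pairs K &, injective support}.
  move=> [A B] [C D]; rewrite !inE /= => /and3P[_ _ AB] /and3P[_ _ CD] eqABCD.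
  have := set21 A B; have := set22 A B; rewrite [[set A; B]]eqABCD /= !inE.
  case/orP=> /eqP eqB; case/orP=> /eqP eqA; rewrite eqA eqB ?properxx // in AB *.
  by have := proper_trans AB CD; rewrite properxx.
rewrite -cards_draws -(card_in_imset support_inj).
set draws := [set P | _]; have sub_draws : support @: proper_pairs K \subset draws.
  apply/subsetP => _ /imsetP[[A B] + ->]; rewrite !inE /= => /and3P[AK BK sAB].
  by rewrite subUset !sub1set AK BK cards2 (proper_neq sAB).
have [le_card eq_card] := subset_leqif_cards sub_draws; split=> //; rewrite {}eq_card.
rewrite eqEsubset sub_draws /=; apply/subsetP/is_chainP => [all_pairs A B AK BK|chK P].
  have [->|neqAB] := eqVneq A B; first by rewrite nestedxx.
  have /all_pairs/imsetP[[C D]] : [set A; B] \in draws.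
    by rewrite inE subUset !sub1set AK BK cards2 neqAB.
  rewrite inE /= => /and3P[_ _ /proper_sub sCD] eqABCD.
  have := set21 A B; have := set22 A B; rewrite [[set A; B]]eqABCD /= !inE.
  by case/orP=> /eqP eqB; case/orP=> /eqP eqA; rewrite /nested eqA eqB ?subxx ?sCD ?orbT.
rewrite inE => /andP[/[swap] /cards2P[A [B [neqAB ->]]]].
rewrite subUset !sub1set => /andP[AK BK].
have /orP[AB|BA] : (A \proper B) || (B \proper A) by rewrite -nested_proper neqAB chK.
  by apply/imsetP; exists (A, B); rewrite ?inE ?AK ?BK.
by apply/imsetP; exists (B, A); rewrite ?inE ?AK ?BK // /support setUC.
Qed.

Lemma chain_spread (T : finType) (M : {set {set T}}) : is_chain M -> M != set0 ->
  exists A D, [/\ A \in M, D \in M, A \subset D & #|M| <= #|D :\: A|.+1].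
Proof.
move=> /is_chainP chM /set0Pn[A0 A0M].
case: (arg_minnP (fun A : {set T} => #|A|) A0M) => A /= AM Amin.
case: (arg_maxnP (fun A : {set T} => #|A|) A0M) => D /= DM Dmax.
have sAD : A \subset D.
  case/orP: (chM A D AM DM) => // sDA.
  rewrite (@nested_card_inj _ A D) ?chM //.
  by apply/eqP; rewrite eqn_leq Amin // subset_leq_card.
exists A, D; split=> //; rewrite cardsDS //.
rewrite [#|M|]cardE -(size_map (fun A : {set T} => #|A|)).
rewrite -[leqRHS](size_iota #|A|); apply: uniq_leq_size.
  rewrite map_inj_in_uniq ?enum_uniq // => X Y; rewrite !mem_enum => XM YM.
  exact: nested_card_inj (chM _ _ XM YM).
move=> _ /mapP[X + ->]; rewrite mem_enum mem_iota => XM.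
by have := Amin _ XM; have := Dmax _ XM; rewrite /geq /=; lia.
Qed.

(** * Upper bound *)

Definition chains_meeting (n : nat) (K : {set {set 'I_n}}) : {set 'S_n} :=
  \bigcup_(A in K) chains_through A.

Definition convex_hull (T : finType) (K : {set {set T}}) : {set {set T}} :=
  [set S : {set T} | [exists A in K, exists D in K, (A \subset S) && (S \subset D)]].

Lemma convex_hullP (T : finType) (K : {set {set T}}) (S : {set T}) :
  reflect (exists A D : {set T}, [/\ A \in K, D \in K, A \subset S & S \subset D])
    (S \in convex_hull K).
Proof.
rewrite inE; apply: (iffP exists_inP) => [[A AK]|[A [D [AK DK AS SD]]]].
  by case/exists_inP=> D DK /andP[AS SD]; exists A, D.
by exists A => //; apply/exists_inP; exists D; rewrite // AS.
Qed.

Lemma sub_convex_hull (T : finType) (K : {set {set T}}) : K \subset convex_hull K.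
Proof. by apply/subsetP => A AK; apply/convex_hullP; exists A, A; rewrite !subxx. Qed.

Lemma chains_meetingS n (K L : {set {set 'I_n}}) :
  K \subset L -> chains_meeting K \subset chains_meeting L.
Proof.
move=> /subsetP sKL; apply/bigcupsP => A /sKL AL.
exact: (bigcup_sup A) AL.
Qed.

Lemma chains_meeting_full n (K : {set {set 'I_n}}) :
  (set0 \in K) || (setT \in K) -> chains_meeting K = setT.
Proof.
move=> trivialK; apply/eqP; rewrite -subTset.
case/orP: trivialK => setK; first by rewrite -(@chains_through0 n); apply: bigcup_sup.
by rewrite -(@chains_throughT n); apply: bigcup_sup.
Qed.

Lemma chain_hull_meeting n (K M : {set {set 'I_n}}) :
    M \subset K -> is_chain M -> M != set0 ->
  n`! <= central_bin (n - #|M|.-1) * #|chains_meeting (convex_hull K)|.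
Proof.
move=> /subsetP MK chM M_neq0; have [A [D [AM DM sAD spread]]] := chain_spread chM M_neq0.
apply: leq_trans (card_chains_through_interval sAD) (leq_mul _ (subset_leq_card _)).
  by apply: leq_trans (bin_le_central _ _) (leq_central_bin _); lia.
apply/bigcupsP => S /andP[AS SD]; apply: bigcup_sup.
by apply/convex_hullP; exists A, D; rewrite !MK.
Qed.

Definition component (n : nat) (F : {set {set 'I_n}}) (R : {set 'I_n}) : {set {set 'I_n}} :=
  [set A in F | fingraph.root (comparability F) A == R].

Section Components.
Variables (n : nat) (F : {set {set 'I_n}}).
Let e := comparability F.

Let connect_sym_e : connect_sym e.
Proof. exact/sym_connect_sym/comparability_sym. Qed.

Lemma component_sub R : component F R \subset F.
Proof. by apply/subsetP => A; rewrite inE => /andP[]. Qed.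

Lemma mem_component R A B : A \in component F R -> B \in F ->
  (B \in component F R) = connect e A B.
Proof.
rewrite !inE => /andP[AF /eqP <-] BF.
by rewrite BF eq_sym /= (root_connect connect_sym_e).
Qed.

Lemma nested_component R A B : A \in component F R -> B \in F -> nested A B ->
  B \in component F R.
Proof.
move=> AR BF nestedAB; rewrite (mem_component AR BF).
have [->|neqAB] := eqVneq A B; first exact: connect0.
by apply: connect1; rewrite /e /comparability (subsetP (component_sub R)) // BF neqAB.
Qed.

Lemma card_proper_pairs_components :
  #|proper_pairs F| = \sum_R #|proper_pairs (component F R)|.
Proof.
rewrite -sum1_card (partition_big (fun p => fingraph.root e p.1) predT) //.
apply: eq_bigr => R _; rewrite sum1_card; apply: eq_card => -[A B].
rewrite unfold_in /= !inE /=; apply/idP/idP => [/andP[/and3P[AF BF AB] rootA]|].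
  have AR : A \in component F R by rewrite inE AF.
  have /(nested_component AR BF) : nested A B by rewrite /nested proper_sub.
  by rewrite inE AF rootA AB => ->.
by case/and3P=> /andP[-> ->] /andP[-> _] ->.
Qed.

(* Sets of the two hulls on a common chain are nested, hence so are elements of
   the two components. *)
Lemma component_hulls_disjoint R1 R2 : R1 != R2 ->
  [disjoint chains_meeting (convex_hull (component F R1))
          & chains_meeting (convex_hull (component F R2))].
Proof.
move=> neqR; apply/pred0P => s /=; apply/negP => /andP[].
case/bigcupP=> S1 /convex_hullP[A1 [D1 [A1R D1R AS1 SD1]]] s1.
case/bigcupP=> S2 /convex_hullP[A2 [D2 [A2R D2R AS2 SD2]]] s2.
have disj X : X \in component F R1 -> X \in component F R2 -> False.
  rewrite !inE => /andP[_ /eqP rootR1] /andP[_ /eqP rootR2].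
  by rewrite -rootR1 rootR2 eqxx in neqR.
have subF := subsetP (component_sub _).
case/orP: (chains_through_nested s1 s2) => sS.
  apply: (disj D2) => //; apply: nested_component A1R (subF _ _ D2R) _.
  by rewrite /nested (subset_trans AS1 (subset_trans sS SD2)).
apply: (disj A2) => //; apply: nested_component D1R (subF _ _ A2R) _.
by rewrite /nested (subset_trans AS2 (subset_trans sS SD1)) orbT.
Qed.

Lemma sum_component_hulls_le :
  \sum_R #|chains_meeting (convex_hull (component F R))| <= n`!.
Proof.
under eq_bigr do rewrite -sum1_card.
rewrite -(partition_disjoint_bigcup _ _ component_hulls_disjoint) sum1_card -card_Sn.
exact: max_card.
Qed.

End Components.

Lemma heavy_component n (F : {set {set 'I_n}}) R B : path_free 5 F ->
    B \in component F R -> heavy (comparability F) B ->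
  #|component F R| = 4 /\
  exists M : {set {set 'I_n}}, [/\ M \subset component F R, is_chain M & #|M| = 3].
Proof.
move=> freeF BR; set e := comparability F; set K := component F R.
have sym_e := comparability_sym F.
have short := path_free_simple_paths_lt (isT : 1 < 5) freeF.
case/(heavy_neighbours sym_e (comparability_irr F) short)=> X [Y [Z [uniq4 [BX BY BZ] XY YZ]]].
have cycle4 : ucycle e [:: B; X; Y; Z].
  by rewrite /ucycle uniq4 /= /e BX XY YZ sym_e BZ.
have connE := @ucycle_component _ e [:: B; X; Y; Z] sym_e short cycle4 B (mem_head _ _).
have KE : K = [set:: [:: B; X; Y; Z]].
  apply/setP => A; rewrite [RHS]inE -connE.
  have [AF|AF] := boolP (A \in F); first exact: mem_component.
  have -> : A \in K = false by rewrite inE (negbTE AF).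
  apply/esym/negbTE; apply: contra AF; rewrite connE !inE.
  by case/or4P=> /eqP ->; [case/and4P: BX|case/and4P: BX|case/and4P: BY|case/and4P: BZ].
split; first by rewrite KE cardsE; apply/card_uniqP.
exists [set:: [:: B; X; Y]]; split.
- by apply/subsetP => A; rewrite KE !inE => /or3P[] ->; rewrite ?orbT.
- have [nested_BX nested_BY nested_XY] : [/\ nested B X, nested B Y & nested X Y].
    by split; [case/and4P: BX|case/and4P: BY|case/and4P: XY].
  pose nestedE := (nestedxx, nested_BX, nested_BY, nested_XY).
  apply/is_chainP => A A'; rewrite !inE => /or3P[] /eqP -> /or3P[] /eqP ->;
    by rewrite ?nestedE // nested_sym nestedE.
- rewrite cardsE; apply/card_uniqP.
  by move: uniq4; rewrite -[X in uniq X]/([:: B; X; Y] ++ [:: Z]) cat_uniq => /andP[].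
Qed.

Lemma heavy_component_bound n (F : {set {set 'I_n}}) R B : 5 <= n -> path_free 5 F ->
    B \in component F R -> heavy (comparability F) B ->
  #|proper_pairs (component F R)| * n`! <=
    5 * central_bin (n - 2) * #|chains_meeting (convex_hull (component F R))|.
Proof.
move=> n_ge5 freeF BR heavyB.
have [cardK [M [MK chM cardM]]] := heavy_component freeF BR heavyB.
set K := component F R in cardK MK *; set hits := chains_meeting _.
have le_pairs_bin := card_proper_pairs_leqif K; rewrite cardK in le_pairs_bin.
have [chK|nchK] := boolP (is_chain K).
  have K_neq0 : K != set0 by rewrite -card_gt0 cardK.
  have := chain_hull_meeting (subxx K) chK K_neq0; rewrite cardK /= -/hits => hits_K.
  have : 3 * central_bin (n - 3) <= 2 * central_bin (n - 2).
    by rewrite -[n - 2]prednK -?subnS ?central_binS //; lia.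
  move=> ratio; apply: leq_trans (leq_mul (le_pairs_bin.1 : _ <= 6) hits_K) _.
  by rewrite mulnA leq_mul //; lia.
have M_neq0 : M != set0 by rewrite -card_gt0 cardM.
have := chain_hull_meeting MK chM M_neq0; rewrite cardM /= -/hits => hits_M.
have lt_pairs : #|proper_pairs K| < 6 by rewrite (ltn_leqif le_pairs_bin).
by rewrite -mulnA leq_mul.
Qed.

Lemma card_chains_through_pair_le n (A B : {set 'I_n}) : 30 <= n ->
    A != B -> nested A B -> A \notin [set set0; setT] -> B \notin [set set0; setT] ->
  10 * central_bin n * #|chains_through A :&: chains_through B| + 9 * n`!
    <= 10 * central_bin n * #|chains_through B|.
Proof.
move=> n_ge30 neqAB nestedAB A_inner B_inner.
have := card_chains_through_nested neqAB nestedAB A_inner B_inner.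
have := card_chains_through B; have := bin_le_central n #|B|.
have := max_card B; rewrite card_ord (cardsC_ord B : _ = n - #|B|).
set c := #|chains_through B|; set d := #|_ :&: _|; move: (n`!) => N le_Bn le_bin <- le_d.
have [large|small] := leqP 10 (minn #|B| (n - #|B|)).
  have : 10 * d <= c by apply: leq_trans le_d; rewrite leq_mul2r; lia.
  nia.
have half_d : 2 * d <= c by apply: leq_trans le_d; rewrite leq_mul2r leq_maxl orbT.
have : 2 * 'C(n, #|B|) <= central_bin n.
  by have [le_B|lt_B] := leqP #|B| (n - #|B|); last rewrite -bin_sub //;
    apply: double_bin_le_central; lia.
nia.
Qed.

Section LightFamily.
Variables (n : nat) (F K : {set {set 'I_n}}).
Let e := comparability F.

Hypothesis KF : K \subset F.
Hypothesis lightK : {in K, forall B, ~~ heavy e B}.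

Let weight_ge2 : {in K &, forall A B, A != B -> nested A B ->
  2 <= edge_weight e A B + edge_weight e B A}.
Proof.
move=> A B AK BK neqAB nestedAB; apply: edge_weight_ge2; first exact: comparability_sym.
by rewrite /e /comparability !(subsetP KF) // neqAB.
Qed.

Let sum_weight_le2 : {in K, forall B, \sum_(A in K) edge_weight e A B <= 2}.
Proof.
move=> B BK; apply: leq_trans (sum_edge_weight_le2 (comparability_sym F) (lightK BK)).
by rewrite big_mkcond leq_sum // => A _; case: ifP.
Qed.

Lemma card_proper_pairs_light : #|proper_pairs K| <= #|K|.
Proof.
rewrite -(@leq_pmul2l 2) // card_proper_pairs.
apply: (@leq_trans (\sum_(A in K) \sum_(B in K) edge_weight e B A)); last first.
  by rewrite mulnC -sum_nat_const; apply: leq_sum => A; apply: sum_weight_le2.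
rewrite big_distrr; under eq_bigr do rewrite big_distrr.
apply: leq_sum_symmetrized => A B AK BK /=; rewrite addnC [leqRHS]addnC.
have [->|neqAB] := eqVneq A B; first by rewrite properxx.
have [nestedAB|] := boolP (nested A B).
  apply: leq_trans (weight_ge2 AK BK neqAB nestedAB).
  have [sAB|_] := boolP (A \proper B); last by case: (B \proper A).
  by rewrite /proper (proper_sub sAB) andbF.
by rewrite /nested negb_or /proper => /andP[/negbTE -> /negbTE ->].
Qed.

Lemma card_light_le : 30 <= n -> [disjoint K & [set set0; setT]] ->
  9 * n`! * #|K| <= 10 * central_bin n * #|chains_meeting K|.
Proof.
move=> n_ge30 disjK; set C := 10 * _; pose w B A := edge_weight e A B.
pose through2 (B A : {set 'I_n}) := #|chains_through B :&: chains_through A|.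
have vertex B : B \in K -> 2 * (9 * n`!) + C * \sum_(A in K) w B A * through2 B A <=
    2 * (C * #|chains_through B|).
  move=> BK; apply: leq_weighted_sum; first exact: sum_weight_le2.
    by have := card_chains_through B; have := bin_le_central n #|B|; rewrite /C; nia.
  move=> A AK; rewrite /w /edge_weight; case: ifP => // /and4P[_ _ neqAB nestedAB] _.
  by rewrite /through2 setIC card_chains_through_pair_le ?(disjointFr disjK).
have total : #|K| * (2 * (9 * n`!)) + C * \sum_(B in K) \sum_(A in K) w B A * through2 B A <=
    2 * (C * \sum_(B in K) #|chains_through B|).
  by rewrite -sum_nat_const !big_distrr -big_split leq_sum.
have bonf : 2 * \sum_(B in K) #|chains_through B| <=
    2 * #|chains_meeting K| + \sum_(B in K) \sum_(A in K) w B A * through2 B A.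
  apply: weighted_bonferroni => A B AK BK neqAB /pred0Pn[s /andP[sA sB]].
  by rewrite addnC weight_ge2 // (chains_through_nested sA sB).
rewrite -(@leq_pmul2l 2) //; move: (leq_mul (leqnn C) bonf) total.
rewrite mulnDr; lia.
Qed.

End LightFamily.

(* [set0] and [setT] are on every chain; the factor 9 / 10 > 4 / 5 in [card_light_le]
   leaves room for counting them as well. *)
Lemma light_family_bound n (F K : {set {set 'I_n}}) : 30 <= n -> K \subset F ->
    {in K, forall B, ~~ heavy (comparability F) B} ->
  #|proper_pairs K| * n`! <= 5 * central_bin (n - 2) * #|chains_meeting (convex_hull K)|.
Proof.
move=> n_ge30 KF lightK; have le_pairs := card_proper_pairs_light KF lightK.
pose L := K :\: [set set0; setT]; have LK : L \subset K := subsetDl _ _.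
have lightL : {in L, forall B, ~~ heavy (comparability F) B}.
  by move=> B /(subsetP LK)/lightK.
have := card_light_le (subset_trans LK KF) lightL n_ge30 _.
rewrite disjoint_sym disjoints_subset setCD subsetUr => /(_ isT) hits_L.
have hits_hull := subset_leq_card (chains_meetingS (subset_trans LK (sub_convex_hull K))).
have := central_bin_le4 (n - 2); rewrite (_ : (n - 2).+2 = n); last lia.
move=> le_central; have [trivialK|] := boolP ((set0 \in K) || (setT \in K)).
  have -> : chains_meeting (convex_hull K) = setT.
    apply: chains_meeting_full.
    by case/orP: trivialK => /(subsetP (sub_convex_hull K)) ->; rewrite ?orbT.
  have cardL : 9 * #|L| <= 10 * central_bin n.
    rewrite -(leq_pmul2r (fact_gt0 n)) mulnAC; apply: leq_trans hits_L _.
    by rewrite -card_Sn leq_mul2l max_card orbT.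
  have le_KL : #|K| <= 2 + #|L|.
    rewrite -(cardsID [set set0; setT] K) leq_add2r.
    by apply: leq_trans (subset_leq_card (subsetIr _ _)) _; rewrite cards2; case: (_ == _).
  have := bin_le_central (n - 2) 1; rewrite bin1 cardsT card_Sn leq_mul2r => large_central.
  by apply/orP; right; lia.
rewrite negb_or => /andP[no_empty no_full].
have eqLK : L = K.
  by apply/setDidPl; rewrite disjoint_sym disjoints_subset subUset !sub1set !inE no_empty.
rewrite eqLK in hits_L hits_hull.
have := leq_mul le_central hits_hull; have := leq_mul le_pairs (leqnn n`!); lia.
Qed.

Lemma copies_P2_le n (F : {set {set 'I_n}}) : 30 <= n -> path_free 5 F ->
  copies_P2 F <= 5 * central_bin (n - 2).
Proof.
move=> n_ge30 freeF; rewrite copies_P2E -(leq_pmul2r (fact_gt0 n)).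
rewrite card_proper_pairs_components big_distrl.
apply: leq_trans (leq_mul (leqnn _) (sum_component_hulls_le F)).
rewrite big_distrr; apply: leq_sum => R _ /=.
have [/exists_inP[B BR heavyB]|/exists_inPn light] :=
  boolP [exists B in component F R, heavy (comparability F) B].
- by apply: heavy_component_bound heavyB; first lia.
- by apply: light_family_bound light => //; apply: component_sub.
Qed.

(** * Lower bound *)

(* The disjoint union of the intervals [T, T :|: Z], for [T] of size [k] in the
   complement of [Z]. *)
Definition cubes (T : finType) (Z : {set T}) (k : nat) : {set {set T}} :=
  [set S : {set T} | #|S :\: Z| == k].

Lemma cubes_path_free n (Z : {set 'I_n}) k : path_free (2 ^ #|Z|).+1 (cubes Z k).
Proof.
move=> d P [s [bij_s adj]] [f [inj_f cube_f mono_f]]; pose g i := f (s i).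
have sizeD i : #|g i :\: Z| = k by apply/eqP; have := cube_f (s i); rewrite inE.
have stepD (i j : 'I_(2 ^ #|Z|).+1) : i.+1 = j -> g i :\: Z = g j :\: Z.
  move=> ij; apply: nested_card_inj; last by rewrite !sizeD.
  have := adj i j; rewrite ij eqxx /nested.
  case/orP=> /andP[/Order.POrderTheory.ltW/mono_f le_ij _]; first by rewrite setSD.
  by rewrite (setSD _ le_ij) orbT.
have constD i : g i :\: Z = g ord0 :\: Z.
  case: i => m; elim: m => [|m IHm] lt_m; first by congr (g _ :\: Z); apply: val_inj.
  by rewrite -(IHm (ltnW lt_m)); apply/esym/stepD.
have inj_gZ : injective (fun i => g i :&: Z).
  move=> i j eq_inside; apply: (bij_inj bij_s); apply: inj_f.
  by rewrite -/(g i) -/(g j) -(setID (g i) Z) -(setID (g j) Z) eq_inside !constD.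
have sub_powerset : [set g i :&: Z | i in setT] \subset powerset Z.
  by apply/subsetP => _ /imsetP[i _ ->]; rewrite powersetE subsetIr.
have := subset_leq_card sub_powerset.
by rewrite card_imset // cardsT card_ord card_powerset ltnn.
Qed.

Lemma sum_card_powerset (T : finType) (Z : {set T}) :
  \sum_(B in powerset Z) 2 ^ #|B| = 3 ^ #|Z|.
Proof.
rewrite -[3]/(1 + 2) expnDn.
rewrite (partition_big (fun B : {set T} => inord #|B| : 'I_#|Z|.+1) predT) //=.
apply: eq_bigr => i _; rewrite exp1n mul1n -cards_draws -sum_nat_const.
have inordE (B : {set T}) : B \subset Z -> (inord #|B| == i) = (#|B| == i).
  by move=> /subset_leq_card le_BZ; rewrite -val_eqE /= inordK.
rewrite big_mkcond [RHS]big_mkcond; apply: eq_bigr => B _; rewrite !inE.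
by case: (boolP (B \subset Z)) => //= /inordE ->; case: eqP => // ->.
Qed.

Lemma card_proper_pairs_powerset (T : finType) (Z : {set T}) :
  #|proper_pairs (powerset Z)| = 3 ^ #|Z| - 2 ^ #|Z|.
Proof.
rewrite card_proper_pairs exchange_big -sum_card_powerset.
apply/esym/eqP; rewrite -(eqn_add2r (2 ^ #|Z|)) subnK; last first.
  by rewrite (bigD1 Z) ?powersetE ?subxx ?leq_addr.
rewrite -card_powerset -sum1_card -big_split /=; apply/eqP/eq_bigr => B; rewrite inE => BZ.
rewrite -card_powerset -sum1_card (bigD1 B) ?powersetE //= addnC; congr (_ + 1).
rewrite big_mkcond [RHS]big_mkcond; apply: eq_bigr => A _; rewrite !inE properEneq.
have [AB|_] := boolP (A \subset B); last by rewrite andbF; case: ifP.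
by rewrite (subset_trans AB BZ) andbT; case: (A == B).
Qed.

Lemma card_proper_pairs_cubes_ge n (Z : {set 'I_n}) k :
  'C(n - #|Z|, k) * (3 ^ #|Z| - 2 ^ #|Z|) <= #|proper_pairs (cubes Z k)|.
Proof.
rewrite -cardsC_ord -cards_draws -card_proper_pairs_powerset -cardsX; set D := setX _ _.
pose g (p : {set 'I_n} * ({set 'I_n} * {set 'I_n})) := (p.1 :|: p.2.1, p.1 :|: p.2.2).
have outside (T A : {set 'I_n}) : T \subset ~: Z -> A \subset Z -> (T :|: A) :\: Z = T.
  move=> TZ AZ; rewrite setDUl (eqP (_ : A :\: Z == set0)) ?setD_eq0 // setU0.
  by apply/setDidPl; rewrite disjoints_subset.
have inside (T A : {set 'I_n}) : T \subset ~: Z -> A \subset Z -> (T :|: A) :&: Z = A.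
  move=> TZ AZ; rewrite setIUl (setIidPl AZ) (eqP (_ : T :&: Z == set0)) ?set0U //.
  by rewrite setI_eq0 disjoints_subset.
have inj_g : {in D &, injective g}.
  move=> [T [A B]] [T' [A' B']]; rewrite !inE /= => /and3P[/andP[TZ _] AZ /andP[BZ _]].
  move=> /and3P[/andP[TZ' _] AZ' /andP[BZ' _]] [eqA eqB].
  rewrite -(outside T A) // eqA outside // -(inside T A) // eqA inside //.
  by rewrite -(inside T B) // eqB inside.
rewrite -(card_in_imset inj_g); apply/subset_leq_card/subsetP => _ /imsetP[[T [A B]] + ->].
rewrite !inE /= => /and3P[/andP[TZ cardT] AZ /andP[BZ AB]].
rewrite !outside // cardT properE (setUS _ (proper_sub AB)) /=.
by apply: contra (proper_subn AB) => /(setSI Z); rewrite !inside.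
Qed.

Lemma La_path5_P2 n : 30 <= n -> La_path_P2 n 5 = 5 * central_bin (n - 2).
Proof.
move=> n_ge30; apply/eqP; rewrite eqn_leq; apply/andP; split.
  by apply/bigmax_leqP => F /asboolP; apply: copies_P2_le.
have /card_gt1P[x [y [_ _ neq_xy]]] : 1 < #|'I_n| by rewrite card_ord; lia.
pose Z := [set x; y]; have cardZ : #|Z| = 2 by rewrite cards2 neq_xy.
have := card_proper_pairs_cubes_ge Z (n - 2)./2; rewrite cardZ mulnC => lower.
apply: leq_trans lower _; rewrite -copies_P2E.
apply: (@leq_bigmax_cond _ _ (@copies_P2 n)); apply/asboolP.
by have := @cubes_path_free n Z (n - 2)./2; rewrite cardZ.
Qed.

(** * Asymptotics *)

Import Order.TTheory GRing.Theory Num.Theory numFieldNormedType.Exports.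
Local Open Scope classical_set_scope.
Local Open Scope ring_scope.

Lemma central_bin_ratio_cvg (R : realType) :
  (central_bin n)%:R / (central_bin n.+2)%:R @[n --> \oo] --> (4%:R^-1 : R).
Proof.
apply: (@squeeze_cvgr _ _ _ _ (fun=> 4%:R^-1) (fun n => 4%:R^-1 * (1 + harmonic n))).
- near=> n; have cb_gt0 : 0 < (central_bin n.+2)%:R :> R by rewrite ltr0n central_bin_gt0.
  have n1_gt0 : 0 < n.+1%:R :> R by rewrite ltr0n.
  rewrite ler_pdivlMr // ler_pdivrMr //; apply/andP; split.
    by rewrite ler_pdivrMl // -natrM ler_nat central_bin_le4.
  have -> : 4%:R^-1 * (1 + harmonic n) = (4 * n.+1)%:R^-1 * n.+2%:R :> R.
    by rewrite /harmonic /= natrM -[n.+2%:R]natr1; field; rewrite nat1r lt0r_neq0.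
  by rewrite -mulrA ler_pdivlMl ?ltr0n // -!natrM ler_nat central_bin_ge4.
- exact: cvg_cst.
- rewrite -[X in _ --> X]mulr1; apply: cvgM; first exact: cvg_cst.
  rewrite -[X in _ --> X]addr0; apply: cvgD; first exact: cvg_cst.
  exact: cvg_harmonic.
Unshelve. all: by end_near.
Qed.

Theorem theorem6 (R : realType) :
  exists e : nat -> R,
    e n @[n --> \oo] --> (0 : R) /\
    \forall n \near \oo,
      La_path_P2 n 5 = (5 * 'C(n - 2, n./2 - 1))%N /\
      (5 * 'C(n - 2, n./2 - 1))%:R = (5%:R / 4%:R + e n) * 'C(n, n./2)%:R :> R.
Proof.
pose ratio n : R := (central_bin (n - 2))%:R / (central_bin n)%:R.
have half_sub2 n : (n./2 - 1 = (n - 2)./2)%N by lia.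
exists (fun n => 5%:R * (ratio n - 4%:R^-1)); split.
  rewrite -[X in _ --> X](mulr0 5%:R) -(subrr 4%:R^-1).
  apply: cvgM; first exact: cvg_cst.
  apply: cvgB; last exact: cvg_cst.
  rewrite -(cvg_shiftn 2); under eq_fun do rewrite /ratio addnK addn2.
  exact: central_bin_ratio_cvg.
exists 30 => // n /= n_ge30; rewrite half_sub2; split; first exact: La_path5_P2.
have cb_neq0 : (central_bin n)%:R != 0 :> R by rewrite pnatr_eq0 -lt0n central_bin_gt0.
by rewrite natrM /ratio -/(central_bin _) -/(central_bin n); field.
Qed.
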